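(* For every fixed integer $k\ge 1$, there are only finitely many (up to isomorphism) $k$-vertex-critical $(P_5,P_2+2P_1)$-free graphs.
   Context: All graphs are finite and simple. $P_t$ is the path on $t$ vertices; $P_2+2P_1$ is the disjoint union of an edge and two isolated vertices. A graph is $(P_5,P_2+2P_1)$-free if it has no induced subgraph isomorphic to $P_5$ or to $P_2+2P_1$. A graph $G$ is $k$-vertex-critical if $\chi(G)=k$ and $\chi(G-v)<k$ for every vertex $v$, where $\chi$ is the chromatic number. *)

(* Defs.v *)
From mathcomp Require Import all_boot.
Set Implicit Arguments.
Unset Strict Implicit.
Unset Printing Implicit Defensive.

Record sgraph := SGraph {
  vertex :> finType;
  edge : rel vertex;
  edge_sym : symmetric edge;
  edge_irr : irreflexive edge
}.

Definition isomorphic (G H : sgraph) : Prop :=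
  exists f : G -> H, bijective f /\ forall x y, edge (f x) (f y) = edge x y.

Section Induced.
Variables (G : sgraph) (A : {set G}).

Definition induced_edge : rel {x : G | x \in A} :=
  fun x y => edge (val x) (val y).

Lemma induced_edge_sym : symmetric induced_edge.
Proof. by move=> x y; apply: edge_sym. Qed.

Lemma induced_edge_irr : irreflexive induced_edge.
Proof. by move=> x; apply: edge_irr. Qed.

Definition induced : sgraph := SGraph induced_edge_sym induced_edge_irr.
End Induced.

Definition delete_vertex (G : sgraph) (v : G) : sgraph := induced [set~ v].

Definition contains_induced (G H : sgraph) : Prop :=
  exists A : {set G}, isomorphic (induced A) H.

Section PathGraph.
Variable t : nat.

Definition path_edge : rel 'I_t :=
  fun i j => (i.+1 == j :> nat) || (j.+1 == i :> nat).

Lemma path_edge_sym : symmetric path_edge.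
Proof. by move=> i j; rewrite /path_edge orbC. Qed.

Lemma path_edge_irr : irreflexive path_edge.
Proof. by move=> i; rewrite /path_edge orbb gtn_eqF. Qed.

Definition path_graph : sgraph := SGraph path_edge_sym path_edge_irr.
End PathGraph.

Section DisjointUnion.
Variables G H : sgraph.

Definition union_edge : rel (G + H)%type := fun x y =>
  match x, y with
  | inl u, inl v => edge u v
  | inr u, inr v => edge u v
  | _, _ => false
  end.

Lemma union_edge_sym : symmetric union_edge.
Proof. by case=> x [] y //=; apply: edge_sym. Qed.

Lemma union_edge_irr : irreflexive union_edge.
Proof. by case=> x /=; apply: edge_irr. Qed.

Definition disjoint_union : sgraph := SGraph union_edge_sym union_edge_irr.
End DisjointUnion.

Definition P5 : sgraph := path_graph 5.

Definition P2_2P1 : sgraph :=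
  disjoint_union (path_graph 2)
                 (disjoint_union (path_graph 1) (path_graph 1)).

Definition P5_P2_2P1_free (G : sgraph) : Prop :=
  ~ contains_induced G P5 /\ ~ contains_induced G P2_2P1.

Definition proper_coloring (G : sgraph) k (c : {ffun G -> 'I_k}) : bool :=
  [forall x, forall y, edge x y ==> (c x != c y)].

Definition colorable (G : sgraph) k : bool :=
  [exists c : {ffun G -> 'I_k}, proper_coloring c].

Lemma colorable_card (G : sgraph) : exists k, colorable G k.
Proof.
exists #|G|; apply/existsP; exists [ffun x => enum_rank x].
apply/forallP=> x; apply/forallP=> y; apply/implyP=> exy; rewrite !ffunE.
by apply: contraTneq exy => /enum_rank_inj->; rewrite edge_irr.
Qed.

Definition chromatic_number (G : sgraph) : nat := ex_minn (colorable_card G).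

Definition vertex_critical k (G : sgraph) : Prop :=
  chromatic_number G = k /\
  forall v : G, chromatic_number (delete_vertex v) < k.

Definition finitely_many_up_to_iso (P : sgraph -> Prop) : Prop :=
  exists (n : nat) (F : 'I_n -> sgraph),
    forall G : sgraph, P G -> exists i, isomorphic G (F i).

(* Main.v *)
Require Import Defs.
From mathcomp Require Import all_boot.

(** Let [S] be a maximum independent set of a [k]-vertex-critical
    [(P5, P2+2P1)]-free graph [G].  A vertex outside [S] has a neighbour in
    [S], so by [P2+2P1]-freeness it misses at most one vertex of [S].  By
    criticality no neighbourhood is contained in that of a nonadjacent vertex,
    so (if [|S| >= 2]) every [s] in [S] is the only vertex of [S] missed by
    some [v_s].  If [|S| >= 3], two nonadjacent [v_a], [v_b] would give an
    induced path [b v_a c v_b a]; hence the [v_s] form a clique avoiding [S],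
    so [|S| < k] by criticality.  Thus [|S| <= maxn k 2], and as [G] is a union
    of [k] independent sets, [|G| <= k * maxn k 2]. *)

Set Implicit Arguments.
Unset Strict Implicit.
Unset Printing Implicit Defensive.

(** * Embeddings, and finiteness from a bound on the order *)

Lemma isomorphic_sym (G H : sgraph) : isomorphic G H -> isomorphic H G.
Proof.
case=> f [[g fK gK] fE]; exists g; split; first by exists f.
by move=> x y; rewrite -fE !gK.
Qed.

Lemma contains_induced_embedding (G H : sgraph) (f : H -> G) :
  injective f -> (forall x y, edge (f x) (f y) = edge x y) ->
  contains_induced G H.
Proof.
move=> f_inj fE; exists (f @: H); apply: isomorphic_sym.
exists (fun x => exist _ (f x) (imset_f f (isT : x \in H))); split; last exact: fE.
apply: inj_card_bij; first by move=> x y [/f_inj].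
by rewrite card_sig card_imset.
Qed.

(** Symmetrising [r] and removing the diagonal turns any Boolean table into a simple graph, so the
    codes form a finite type. *)
Definition relation_graph (n : nat) (r : {ffun 'I_n * 'I_n -> bool}) : sgraph.
Proof.
apply: (@SGraph 'I_n (fun x y => (x != y) && (r (x, y) || r (y, x)))).
- by move=> x y; rewrite eq_sym orbC.
- by move=> x; rewrite eqxx.
Defined.

(** The list runs through all pairs of an order at most [N] and an adjacency table; [G] is matched
    with its own table, read along [enum_rank]. *)
Lemma finitely_many_of_bounded (P : sgraph -> Prop) (N : nat) :
  (forall G, P G -> #|G| <= N) -> finitely_many_up_to_iso P.
Proof.
move=> PN; pose T : finType := {n : 'I_N.+1 & {ffun 'I_n * 'I_n -> bool}}.
exists #|T|, (fun i => relation_graph (tagged (enum_val i : T))) => G /PN leGN.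
pose r := [ffun p : 'I_#|G| * 'I_#|G| => edge (enum_val p.1) (enum_val p.2)].
pose t : T := Tagged (fun n : 'I_N.+1 => {ffun 'I_n * 'I_n -> bool})
  (r : {ffun 'I_(Ordinal (leGN : #|G| < N.+1)) * 'I__ -> bool}).
exists (enum_rank t); rewrite enum_rankK.
exists (enum_rank : G -> 'I_#|G|); split.
  by exists enum_val; [exact: enum_rankK | exact: enum_valK].
move=> x y; rewrite /= !ffunE /= !enum_rankK (inj_eq enum_rank_inj).
by rewrite [edge y x]edge_sym orbb; case: eqP => // ->; rewrite edge_irr.
Qed.

(** * Independent sets, cliques and colourings *)

Definition independent (G : sgraph) (S : {set G}) : bool :=
  [forall x in S, forall y in S, ~~ edge x y].

Lemma independentP (G : sgraph) (S : {set G}) :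
  reflect {in S &, forall x y, ~~ edge x y} (independent S).
Proof.
apply: (iffP forall_inP) => [h x y xS yS | h x xS].
  by move/forall_inP: (h x xS); apply.
by apply/forall_inP => y yS; apply: h.
Qed.

Lemma colorableP (G : sgraph) k :
  reflect (exists c : G -> 'I_k, forall x y, edge x y -> c x != c y)
          (colorable G k).
Proof.
apply: (iffP existsP) => [[c /forallP cP] | [c cP]].
  by exists c => x y; move/forallP: (cP x) => /(_ y)/implyP.
exists (finfun c); apply/forallP => x; apply/forallP => y.
by apply/implyP; rewrite !ffunE; apply: cP.
Qed.

Lemma colorable_chromatic_number (G : sgraph) :
  colorable G (chromatic_number G).
Proof. by rewrite /chromatic_number; case: ex_minnP. Qed.

Lemma chromatic_number_min (G : sgraph) k :
  colorable G k -> chromatic_number G <= k.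
Proof. by rewrite /chromatic_number; case: ex_minnP => m _; apply. Qed.

Lemma clique_card_colorable (G : sgraph) k (A : {set G}) :
  {in A &, forall x y, x != y -> edge x y} -> colorable G k -> #|A| <= k.
Proof.
move=> clA /colorableP[c cP]; rewrite -[k]card_ord -(@card_in_imset _ _ c A).
  exact: max_card.
move=> x y xA yA cxy; apply/eqP; apply: contraT => /(clA x y xA yA)/cP.
by rewrite cxy eqxx.
Qed.

Lemma card_colorable_independent (G : sgraph) k m :
  colorable G k -> (forall S : {set G}, independent S -> #|S| <= m) ->
  #|G| <= k * m.
Proof.
move=> /colorableP[c cP] im; rewrite -sum1_card.
rewrite (partition_big c xpredT) //= -[X in X * m]card_ord -sum_nat_const.
apply: leq_sum => i _; rewrite sum1_card.
rewrite (_ : #|_| = #|[set x | c x == i]|); last first.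
  by apply: eq_card => x; rewrite !inE.
apply: im; apply/independentP => x y; rewrite !inE => /eqP<- /eqP cyx.
by apply/negP => /cP; rewrite cyx eqxx.
Qed.

(** * Consequences of vertex-criticality *)

Section Critical.
Variables (G : sgraph) (k : nat).
Hypothesis critG : vertex_critical k G.

(** The clique survives in [G - v], which is colourable with fewer than [k] colours. *)
Lemma critical_clique_lt (v : G) (A : {set G}) :
  v \notin A -> {in A &, forall x y, x != y -> edge x y} -> #|A| < k.
Proof.
move=> vA clA; have [_ /(_ v)] := critG; apply: leq_ltn_trans.
have sAv : {in A, forall x, x \in [set~ v]}.
  by move=> x xA; rewrite !inE; apply: contraNneq vA => <-.
pose B : {set delete_vertex v} := [set x | val x \in A].
have -> : #|A| = #|B|.
  rewrite -(card_imset _ (val_inj : injective (val : delete_vertex v -> G))).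
  apply: eq_card => x; apply/idP/imsetP => [xA | [y]]; last first.
    by rewrite inE => yA ->.
  by exists (exist _ x (sAv x xA) : delete_vertex v); rewrite ?inE.
apply: clique_card_colorable (colorable_chromatic_number _).
by move=> x y; rewrite !inE => xA yA nxy; apply: clA.
Qed.

(* Otherwise a colouring of [G - u] extends to [u] by the colour of [w]. *)
Lemma critical_private_neighbor (u w : G) :
  u != w -> ~~ edge u w -> exists2 v, edge u v & ~~ edge w v.
Proof.
move=> nuw Euw; have [chiG /(_ u) ltk] := critG.
case: (pickP [pred v | edge u v && ~~ edge w v]) => [v /andP[] | sub].
  by exists v.
have {}sub v : edge u v -> edge w v.
  by move=> uv; move: (sub v) => /=; rewrite uv => /negbFE.
suff : colorable G (chromatic_number (delete_vertex u)).
  by move/chromatic_number_min; rewrite chiG leqNgt ltk.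
have /colorableP[c cP] := colorable_chromatic_number (delete_vertex u).
have wu : w \in [set~ u] by rewrite !inE eq_sym.
(* As the default of [insubd], [w'] is the image of [u] alone among vertices outside [G - u], so [u]
   gets the colour of [w]. *)
pose w' : delete_vertex u := exist _ w wu.
apply/colorableP; exists (fun x => c (insubd w' x)).
have ins x : x != u -> val (insubd w' x) = x.
  by move=> xu; rewrite insubdK // !inE.
have insu : insubd w' u = w' by rewrite /insubd insubN // !inE eqxx.
move=> x y xy; apply: cP; rewrite /= /induced_edge.
have [xu|xu] := eqVneq x u; have [yu|yu] := eqVneq y u.
- by rewrite xu yu edge_irr in xy.
- by rewrite xu insu ins //= sub // -xu.
- by rewrite yu insu ins //= edge_sym sub // edge_sym -yu.
- by rewrite !ins.
Qed.

End Critical.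

(** * Recognising the two forbidden subgraphs *)

Lemma P5_contained (G : sgraph) (x0 x1 x2 x3 x4 : G) :
  uniq [:: x0; x1; x2; x3; x4] ->
  edge x0 x1 -> edge x1 x2 -> edge x2 x3 -> edge x3 x4 ->
  ~~ edge x0 x2 -> ~~ edge x0 x3 -> ~~ edge x0 x4 ->
  ~~ edge x1 x3 -> ~~ edge x1 x4 -> ~~ edge x2 x4 ->
  contains_induced G P5.
Proof.
move=> Ux e01 e12 e23 e34.
move=> /negPf n02 /negPf n03 /negPf n04 /negPf n13 /negPf n14 /negPf n24.
pose s := [:: x0; x1; x2; x3; x4].
apply: (@contains_induced_embedding G P5 (fun i : 'I_5 => nth x0 s i)).
  by move=> i j /eqP; rewrite nth_uniq // => /eqP/val_inj.
case=> [[|[|[|[|[|//]]]]] hi] [[|[|[|[|[|//]]]]] hj];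
  rewrite /= /path_edge /= ?edge_irr //;
  by rewrite ?e01 ?e12 ?e23 ?e34 ?n02 ?n03 ?n04 ?n13 ?n14 ?n24 // edge_sym
     ?e01 ?e12 ?e23 ?e34 ?n02 ?n03 ?n04 ?n13 ?n14 ?n24.
Qed.

Lemma P2_2P1_contained (G : sgraph) (u v a b : G) :
  a != b -> edge u v -> ~~ edge a b ->
  ~~ edge u a -> ~~ edge u b -> ~~ edge v a -> ~~ edge v b ->
  contains_induced G P2_2P1.
Proof.
move=> ab uv /negPf nab /negPf ua /negPf ub /negPf va /negPf vb.
have nuv : u != v by apply: contraTneq uv => ->; rewrite edge_irr.
have vu : edge v u by rewrite edge_sym.
(* Identifying an end of the edge with [a] or [b] would make the other end adjacent to that
   vertex. *)
have nua : u != a by apply: contraTneq vu => ->; rewrite va.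
have nub : u != b by apply: contraTneq vu => ->; rewrite vb.
have nva : v != a by apply: contraTneq uv => ->; rewrite ua.
have nvb : v != b by apply: contraTneq uv => ->; rewrite ub.
pose f (x : P2_2P1) := match x with
  | inl i => nth u [:: u; v] (i : 'I_2)
  | inr (inl _) => a
  | inr (inr _) => b
  end.
apply: (@contains_induced_embedding G P2_2P1 f).
  move=> [[[|[|//]] hi]|[[[|//] hi]|[[|//] hi]]]
         [[[|[|//]] hj]|[[[|//] hj]|[[|//] hj]]] /= /eqP;
  rewrite ?(negPf ab) ?(negPf nuv) ?(negPf nua) ?(negPf nub) ?(negPf nva)
    ?(negPf nvb) //;
  try (by rewrite eq_sym ?(negPf ab) ?(negPf nuv) ?(negPf nua) ?(negPf nub)
    ?(negPf nva) ?(negPf nvb));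
  by move=> _; do ?congr inl; do ?congr inr; do ?congr inl; apply: val_inj.
by move=> [[[|[|//]] hi]|[[[|//] hi]|[[|//] hi]]]
       [[[|[|//]] hj]|[[[|//] hj]|[[|//] hj]]];
  rewrite /= /path_edge /= ?edge_irr ?uv ?vu ?nab ?ua ?ub ?va ?vb //
    edge_sym ?nab ?ua ?ub ?va ?vb.
Qed.

(** * Inclusion-maximal independent sets in a critical free graph *)

Section Free.
Variables (G : sgraph) (k : nat).
Hypotheses (critG : vertex_critical k G) (freeG : P5_P2_2P1_free G).
Variable S : {set G}.
Hypothesis maxS : maxset (@independent G) S.

Let indS : {in S &, forall x y, ~~ edge x y}.
Proof. exact/independentP/(maxsetp maxS). Qed.

Lemma maximal_independent_neighbor v :
  v \notin S -> exists2 u, u \in S & edge v u.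
Proof.
move=> vS; apply/exists_inP; apply: contraT => /exists_inPn nv.
have indvS : independent (v |: S).
  apply/independentP => x y; rewrite !inE.
  move=> /predU1P[->|xS] /predU1P[->|yS].
  - by rewrite edge_irr.
  - exact: nv.
  - by rewrite edge_sym nv.
  - exact: indS.
by rewrite -((maxsetP maxS).2 _ indvS (subsetUr _ _)) setU11 in vS.
Qed.

(** Otherwise the edge from [v] to a neighbour in [S], together with [a] and [b], induces
    [P2_2P1]. *)
Lemma maximal_independent_missed_unique v a b :
  v \notin S -> a \in S -> b \in S -> ~~ edge v a -> ~~ edge v b -> a = b.
Proof.
move=> vS aS bS va vb; have [u uS vu] := maximal_independent_neighbor vS.
apply/eqP; apply: contraT => ab; case: (freeG.2).
by apply: (P2_2P1_contained ab vu) => //; apply: indS.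
Qed.

(** For another [b] in [S], criticality gives a neighbour of [b] not adjacent to [a]; being adjacent
    to [b], it lies outside [S]. *)
Lemma missing_vertex_exists a :
  1 < #|S| -> a \in S -> exists v, (v \notin S) && ~~ edge v a.
Proof.
move=> S1 aS; have /card_gt0P[b] : 0 < #|S :\ a|.
  by rewrite (cardsD1 a) aS in S1.
rewrite !inE => /andP[ba bS].
have [v bv av] := critical_private_neighbor critG ba (indS bS aS).
exists v; rewrite edge_sym av andbT.
by apply: contraL bv => vS; apply: indS.
Qed.

Lemma missing_vertices_adjacent v w a b :
  2 < #|S| -> a \in S -> b \in S -> a != b ->
  v \notin S -> ~~ edge v a -> w \notin S -> ~~ edge w b -> edge v w.
Proof.
move=> S2 aS bS ab vS va wS wb.
have /card_gt0P[c] : 0 < #|S :\ a :\ b|.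
  by move: S2; rewrite (cardsD1 a) aS (cardsD1 b) !inE eq_sym ab bS.
rewrite !inE => /and3P[cb ca cS].
have adj x y z : x \notin S -> y \in S -> z \in S -> ~~ edge x y -> z != y ->
    edge x z.
  move=> xS yS zS xy; apply: contraNT => xz.
  exact/eqP/(maximal_independent_missed_unique xS).
have vb : edge v b by apply: (adj v a); rewrite // eq_sym.
have vc : edge v c by apply: (adj v a).
have wa : edge w a by apply: (adj w b).
have wc : edge w c by apply: (adj w b).
have out x y : x \in S -> y \notin S -> x != y.
  by move=> xS; apply: contraNneq => <-.
apply: contraT => vw; case: (freeG.1).
apply: (@P5_contained G b v c w a) => //; try exact: indS.
(* The vertex [b] separates them: [v] is adjacent to it and [w] is not. *)
- have nvw : v != w by apply: contraTneq vb => ->.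
  rewrite /= !inE !negb_or (eq_sym v c) (eq_sym v a) (eq_sym w a).
  by rewrite (eq_sym b c) cb (eq_sym b a) ab nvw ca !out.
all: by rewrite edge_sym.
Qed.

Lemma maximal_independent_card : #|S| <= maxn k 2.
Proof.
rewrite leq_max; have [|S2] := leqP #|S| 2; first by rewrite orbT.
rewrite orbF ltnW //; have S1 : 1 < #|S| := ltnW S2.
have /card_gt0P[s sS] : 0 < #|S| := ltnW S1.
(* The default [s] is never taken on [S], by [missing_vertex_exists]. *)
pose m a := if [pick v | (v \notin S) && ~~ edge v a] is Some v then v else s.
have mP a : a \in S -> (m a \notin S) && ~~ edge (m a) a.
  move=> /(missing_vertex_exists S1)[v mv]; rewrite /m.
  by case: pickP => // /(_ v); rewrite mv.
have m_adj : {in S &, forall a b, a != b -> edge (m a) (m b)}.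
  move=> a b aS bS ab.
  have [/andP[maS ma] /andP[mbS mb]] := (mP a aS, mP b bS).
  exact: missing_vertices_adjacent ab maS ma mbS mb.
(* Distinct elements of [S] have adjacent, hence distinct, images, so [m @: S] is a clique of size
   [#|S|]; it avoids [s], the vertex to delete. *)
rewrite -(@card_in_imset _ _ m S).
  apply: (critical_clique_lt critG (v := s)).
    apply/imsetP => -[a /mP/andP[maS _] sma].
    by rewrite -sma sS in maS.
  move=> _ _ /imsetP[a aS ->] /imsetP[b bS ->] mab; apply: m_adj => //.
  by apply: contraNneq mab => ->.
move=> a b aS bS mab; apply/eqP; apply: contraT => /(m_adj a b aS bS).
by rewrite mab edge_irr.
Qed.

End Free.

Theorem theorem16 (k : nat) (hk : 1 <= k) :
  finitely_many_up_to_iso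
    (fun G : sgraph => vertex_critical k G /\ P5_P2_2P1_free G).
Proof.
apply: (@finitely_many_of_bounded _ (k * maxn k 2)) => G [critG freeG].
apply: card_colorable_independent.
  by rewrite -critG.1; apply: colorable_chromatic_number.
(* Any independent set extends to an inclusion-maximal one, to which the bound applies. *)
move=> S /maxset_exists[M maxM /subset_leq_card leSM].
exact: leq_trans leSM (maximal_independent_card critG freeG maxM).
Qed.
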